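(* Let $\mathcal{A}$ be a unital $C^*$-algebra, $\mathcal{H}$ a Hilbert $\mathcal{A}$-module, $K\in End_{\mathcal{A}}^{*}(\mathcal{H})$, $\mathbb{J}\subseteq\mathbb{N}$ a finite or countable index set, and $\{T_i\}_{i\in\mathbb{J}}$ a family of adjointable operators on $\mathcal{H}$. Suppose that $\sum_{i\in\mathbb{J}}\langle T_ix,T_ix\rangle$ converges in norm for all $x\in\mathcal{H}$. Then $\{T_i\}_{i\in\mathbb{J}}$ is a $K$-operator frame for $End_{\mathcal{A}}^{*}(\mathcal{H})$ if and only if there exist constants $A,B>0$ such that $$A\|K^*x\|^2\le\Big\|\sum_{i\in\mathbb{J}}\langle T_ix,T_ix\rangle\Big\|\le B\|x\|^2\qquad\text{for all }x\in\mathcal{H}.$$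
   Context: Hilbert $\mathcal{A}$-modules are left modules with $\mathcal{A}$-valued inner product $\langle\cdot,\cdot\rangle$, $\mathcal{A}$-linear in the first variable, with $\langle x,y\rangle=\langle y,x\rangle^*$, complete for $\|x\|=\|\langle x,x\rangle\|^{1/2}$. $End_{\mathcal{A}}^{*}(\mathcal{H})$ is the set of adjointable operators on $\mathcal{H}$. Inequalities between elements of $\mathcal{A}$ refer to the usual order given by the positive cone of $\mathcal{A}$. For $K\in End_{\mathcal{A}}^{*}(\mathcal{H})$, a family $\{T_i\}_{i\in\mathbb{J}}\subset End_{\mathcal{A}}^{*}(\mathcal{H})$ is a $K$-operator frame for $End_{\mathcal{A}}^{*}(\mathcal{H})$ if there exist constants $A,B>0$ such that $A\langle K^*x,K^*x\rangle\le\sum_{i\in\mathbb{J}}\langle T_ix,T_ix\rangle\le B\langle x,x\rangle$ in $\mathcal{A}$ for all $x\in\mathcal{H}$. (The constants in this definition need not be those in the norm inequality.) *)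

(* Defs.v *)
From HB Require Import structures.
From mathcomp Require Import all_boot all_order all_algebra.
From mathcomp Require Export complex.
From mathcomp Require Import all_classical all_reals all_analysis.

Set Implicit Arguments.
Unset Strict Implicit.
Unset Printing Implicit Defensive.

Import Order.TTheory GRing.Theory Num.Theory.
Import numFieldNormedType.Exports.

Local Open Scope classical_set_scope.
Local Open Scope ring_scope.
Local Open Scope complex_scope.

(* Unital C*-algebras over the complex field R[i], presented as complex Banach
   spaces with a multiplication and an involution.  1 != 0 is not required, so
   the zero algebra is included.  The norm `|a| takes its values in R[i], as for
   every normed module over R[i]; these values are nonnegative reals. *)
Record cstarAlgType (R : realType) := CStarAlg {
  cs_space : completeNormedModType R[i] ;
  cs_mul : cs_space -> cs_space -> cs_space ;
  cs_one : cs_space ;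
  cs_star : cs_space -> cs_space ;
  cs_mulA : associative cs_mul ;
  cs_mul1l : left_id cs_one cs_mul ;
  cs_mul1r : right_id cs_one cs_mul ;
  cs_mulDl : left_distributive cs_mul +%R ;
  cs_mulDr : right_distributive cs_mul +%R ;
  cs_mulZl : forall (k : R[i]) a b, cs_mul (k *: a) b = k *: cs_mul a b ;
  cs_mulZr : forall (k : R[i]) a b, cs_mul a (k *: b) = k *: cs_mul a b ;
  cs_starD : forall a b, cs_star (a + b) = cs_star a + cs_star b ;
  cs_starZ : forall (k : R[i]) a, cs_star (k *: a) = k^* *: cs_star a ;
  cs_starM : forall a b, cs_star (cs_mul a b) = cs_mul (cs_star b) (cs_star a) ;
  cs_starK : involutive cs_star ;
  cs_normM : forall a b, `|cs_mul a b| <= `|a| * `|b| ;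
  cs_norm_star : forall a, `|cs_mul (cs_star a) a| = `|a| ^+ 2
}.

(* A Hierarchy-Builder structure joining rings and normed modules is rejected
   (numDomainType already inherits from both without a common join), so the two
   structures are put on this carrier as instances. *)
Definition cs_sort (R : realType) (A : cstarAlgType R) : Type := cs_space A.
Coercion cs_sort : cstarAlgType >-> Sortclass.

HB.instance Definition _ (R : realType) (A : cstarAlgType R) :=
  CompleteNormedModule.copy (cs_sort A) (cs_space A).
HB.instance Definition _ (R : realType) (A : cstarAlgType R) :=
  GRing.Zmodule_isPzRing.Build (cs_sort A) (@cs_mulA R A) (@cs_mul1l R A)
    (@cs_mul1r R A) (@cs_mulDl R A) (@cs_mulDr R A).

Definition star (R : realType) (A : cstarAlgType R) : A -> A := @cs_star R A.

Definition cs_invertible (R : realType) (A : cstarAlgType R) (a : A) : Prop :=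
  exists b : A, a * b = 1 /\ b * a = 1.

Definition spectrum (R : realType) (A : cstarAlgType R) (a : A) : set R[i] :=
  [set k | ~ cs_invertible (k *: (1 : A) - a)].

(* In the order of R[i], 0 <= k means that k is a nonnegative real. *)
Definition cs_pos (R : realType) (A : cstarAlgType R) (a : A) : Prop :=
  star a = a /\ spectrum a `<=` [set k | 0 <= k].

Definition cs_le (R : realType) (A : cstarAlgType R) (a b : A) : Prop :=
  cs_pos (b - a).

(* The norm of a module element with self inner product p. *)
Definition norm_of_inner (R : realType) (A : cstarAlgType R) (p : A) : R[i] :=
  sqrtC `|p|.

(* The complex vector space structure of a Hilbert A-module is the one induced
   by its (unital) A-module structure, k . x = (k *: 1) *: x: it is the only one
   compatible with the scaling of A. *)
HB.mixin Record isHilbertModule (R : realType) (A : cstarAlgType R) H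
    of GRing.Lmodule (cs_sort A) H := {
  inner : H -> H -> A ;
  inner_linear : forall (a : A) (x y z : H),
    inner (a *: x + y) z = a * inner x z + inner y z ;
  inner_star : forall x y : H, inner x y = star (inner y x) ;
  inner_pos : forall x : H, cs_pos (inner x x) ;
  inner_definite : forall x : H, inner x x = 0 -> x = 0 ;
  hilbert_complete : forall u : nat -> H,
    (forall e : R, 0 < e -> exists N : nat, forall m n : nat,
       (N <= m)%N -> (N <= n)%N ->
       norm_of_inner (inner (u m - u n) (u m - u n)) < e%:C) ->
    exists l : H, forall e : R, 0 < e -> exists N : nat, forall n : nat,
      (N <= n)%N -> norm_of_inner (inner (u n - l) (u n - l)) < e%:C
}.

#[short(type="hilbertModType")]
HB.structure Definition HilbertModule (R : realType) (A : cstarAlgType R) :=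
  {H of isHilbertModule R A H & GRing.Lmodule (cs_sort A) H}.

Section HilbertModuleDefs.
Context {R : realType} {A : cstarAlgType R} {H : hilbertModType A}.

Definition hnorm (x : H) : R[i] := norm_of_inner (inner x x).

(* A-linearity and boundedness follow from the existence of an adjoint. *)
Record adjointable := Adjointable {
  adj_fun :> H -> H ;
  adj_fun_ex : exists S : H -> H,
    forall x y : H, inner (adj_fun x) y = inner x (S y)
}.

Definition adjoint (T : adjointable) : H -> H := sval (cid (adj_fun_ex T)).

Lemma adjointP (T : adjointable) (x y : H) :
  inner (T x) y = inner x (adjoint T y).
Proof. exact: (svalP (cid (adj_fun_ex T))). Qed.

Lemma innerBl (x y z : H) : inner (x - y) z = inner x z - inner y z.
Proof. by rewrite addrC -scaleN1r inner_linear mulN1r addrC. Qed.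

Lemma adjoint_unique (T : adjointable) (S : H -> H) :
  (forall x y : H, inner (T x) y = inner x (S y)) -> S = adjoint T.
Proof.
move=> TS; apply/funext => y; apply/eqP; rewrite -subr_eq0; apply/eqP.
apply: (@inner_definite R A H).
have e x : inner (S y) x = inner (adjoint T y) x.
  by rewrite inner_star -TS adjointP -inner_star.
by rewrite innerBl e subrr.
Qed.

(* Families indexed by J are given as sequences whose values outside J are
   never used. *)
Definition frame_psum (J : set nat) (T : nat -> adjointable) (x : H) :
    nat -> A :=
  fun n => \sum_(0 <= i < n | i \in J) inner (T i x) (T i x).

Definition frame_sum (J : set nat) (T : nat -> adjointable) (x : H) : A :=
  limn (frame_psum J T x).

Definition K_operator_frame (K : adjointable) (J : set nat)
    (T : nat -> adjointable) : Prop :=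
  exists a b : R, [/\ 0 < a, 0 < b & forall x : H,
    [/\ cvgn (frame_psum J T x),
        cs_le (a%:C *: inner (adjoint K x) (adjoint K x)) (frame_sum J T x)
      & cs_le (frame_sum J T x) (b%:C *: inner x x)]].

End HilbertModuleDefs.

Arguments adjointable {R A} H.

(* Main.v *)
(* Both inequalities reduce to one fact about positive elements p, q of A: if
   |a p a^*| <= |a q a^*| for all a in A, then p <= q.  The norm inequality
   provides this hypothesis when applied to a x instead of x, since K^* and the
   T_i are A-linear and the norm convergent sum satisfies S(a x) = a S(x) a^*.
   To prove the fact take a = (q + e)^(-1/2): then a q a <= 1, so |a p a| <= 1,
   so a p a <= 1, and conjugating by (q + e)^(1/2) gives p <= q + e.

   Positivity is defined by the spectrum, but it is handled without functional
   calculus or spectral radius: a self-adjoint a is positive iff |t - a| <= t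
   for some t, iff it is the square of a self-adjoint element, the square root
   coming from the iteration y := (c + y^2) / 2 for 1 - sqrt (1 - c). *)
Require Import Defs.
From HB Require Import structures.
From mathcomp Require Import all_boot all_order all_algebra.
From mathcomp Require Import complex.
From mathcomp Require Import all_classical all_reals all_analysis.
From mathcomp Require Import ring lra.
Import Order.TTheory GRing.Theory Num.Theory.
Import numFieldNormedType.Exports.
Local Open Scope classical_set_scope.
Local Open Scope ring_scope.
Local Open Scope complex_scope.

(** * Real-valued norm, real scalars and norm convergence *)

Section CStarAlgebra.
Context {R : realType} {A : cstarAlgType R}.
Implicit Types (a b c d u v : A) (s t e : R).

(** The norm takes values in [R[i]]; its real part loses nothing ([nrE]) and allows estimates in the
    ordered field [R]. *)
Definition nr a : R := complex.Re `|a|.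

Lemma nrE a : `|a| = (nr a)%:C.
Proof.
rewrite /nr; have := normr_ge0 a; case: (`|a|) => x y.
by rewrite lecE /= => /andP[/eqP -> _].
Qed.

Lemma nr_ge0 a : 0 <= nr a.
Proof. by rewrite -(@lecR R) -nrE normr_ge0. Qed.

Lemma nrN a : nr (- a) = nr a.
Proof. by rewrite /nr normrN. Qed.

Lemma nr_distC a b : nr (a - b) = nr (b - a).
Proof. by rewrite -nrN opprB. Qed.

Lemma ler_nrD a b : nr (a + b) <= nr a + nr b.
Proof. by rewrite -(@lecR R) rmorphD /= -!nrE ler_normD. Qed.

Lemma ler_nrM a b : nr (a * b) <= nr a * nr b.
Proof. by rewrite -(@lecR R) rmorphM /= -!nrE; exact: cs_normM. Qed.

Lemma nr_starM a : nr (star a * a) = nr a ^+ 2.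
Proof.
apply: (@complexI R); rewrite rmorphXn /= -!nrE; exact: cs_norm_star.
Qed.

Lemma nr_sq a : star a = a -> nr (a * a) = nr a ^+ 2.
Proof. by move=> sa; rewrite -nr_starM sa. Qed.

Lemma starK a : star (star a) = a. Proof. exact: cs_starK. Qed.
Lemma starD a b : star (a + b) = star a + star b. Proof. exact: cs_starD. Qed.
Lemma starM a b : star (a * b) = star b * star a. Proof. exact: cs_starM. Qed.
Lemma starZ (k : R[i]) a : star (k *: a) = conjc k *: star a.
Proof. exact: cs_starZ. Qed.
Lemma starN a : star (- a) = - star a.
Proof. by rewrite -scaleN1r starZ rmorphN rmorph1 scaleN1r. Qed.
Lemma star0 : star (0 : A) = 0.
Proof. by rewrite -(scale0r (0 : A)) starZ rmorph0 !scale0r. Qed.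
Lemma star1 : star (1 : A) = 1.
Proof. by have := starM (star 1) 1; rewrite mulr1 starK mulr1. Qed.

(** The C*-identity gives |b|^2 = |b^* b| <= |b^*| |b|. Cancelling |b| and applying the result to
    both a and a^* yields equality. *)
Lemma nr_star a : nr (star a) = nr a.
Proof.
suff H b : nr b <= nr (star b) by apply/eqP; rewrite eq_le H -{2}(starK a) H.
have [b0|b0] := eqVneq (nr b) 0; first by rewrite b0 nr_ge0.
have : 0 < nr b by rewrite lt0r b0 nr_ge0.
by move=> b_gt0; rewrite -(ler_pM2r b_gt0) -expr2 -nr_starM ler_nrM.
Qed.

(** The C*-identity at 1 says that n = n^2 for the norm n of 1; n = 0 occurs in the zero algebra,
    hence an inequality. *)
Lemma nr1_le1 : nr (1 : A) <= 1.
Proof.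
have := nr_starM 1; rewrite star1 mul1r => h; have := nr_ge0 (1 : A); nra.
Qed.

Lemma scaleAl' (k : R[i]) a b : k *: (a * b) = (k *: a) * b.
Proof. by rewrite [RHS]cs_mulZl. Qed.
Lemma scaleAr' (k : R[i]) a b : k *: (a * b) = a * (k *: b).
Proof. by rewrite [RHS]cs_mulZr. Qed.

(** The central copy of [R] in [A]: real scaling becomes ring multiplication and is rewritten with
    ring lemmas. *)
Definition scal t : A := t%:C *: (1 : A).

Lemma scalE t a : scal t * a = t%:C *: a.
Proof. by rewrite /scal -scaleAl' mul1r. Qed.
Lemma scalC t a : a * scal t = scal t * a.
Proof. by rewrite scalE /scal -scaleAr' mulr1. Qed.
Lemma scal0 : scal 0 = 0. Proof. by rewrite /scal scale0r. Qed.
Lemma scal1 : scal 1 = 1. Proof. by rewrite /scal scale1r. Qed.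
Lemma scalD s t : scal (s + t) = scal s + scal t.
Proof. by rewrite /scal rmorphD scalerDl. Qed.
Lemma scalN t : scal (- t) = - scal t.
Proof. by rewrite /scal rmorphN scaleNr. Qed.
Lemma scalM s t : scal (s * t) = scal s * scal t.
Proof. by rewrite scalE /scal scalerA rmorphM. Qed.
Lemma star_scal t : star (scal t) = scal t.
Proof. by rewrite /scal starZ star1 conjc_real. Qed.

Lemma nrZ t a : nr (scal t * a) = `|t| * nr a.
Proof.
apply: (@complexI R); rewrite scalE rmorphM /= -!nrE normrZ; congr (_ * _).
by rewrite normc_def /= expr0n addr0 sqrtr_sqr.
Qed.

Lemma nr_scal t : nr (scal t) <= `|t|.
Proof. by rewrite -[scal t]mulr1 nrZ ler_piMr // nr1_le1. Qed.

Lemma nr0 : nr (0 : A) = 0.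
Proof. by rewrite -scal0 -[scal 0]mulr1 nrZ normr0 mul0r. Qed.

Lemma cvg_nrP (u : nat -> A) (l : A) :
  (u @ \oo --> l) <-> ((fun n => nr (l - u n)) @ \oo --> (0 : R)).
Proof.
split.
  move=> /cvgrPdist_lt ul; apply/cvgrPdist_lt => e e0.
  have e0' : 0 < e%:C by rewrite (@ltcR R 0).
  near=> n.
  rewrite sub0r normrN ger0_norm ?nr_ge0 // -(@ltcR R) -nrE.
  near: n; exact: ul.
move=> /cvgrPdist_lt ul; apply/cvgrPdist_lt => -[e e'].
rewrite ltcE /= => /andP[/eqP -> e0].
near=> n.
rewrite -/(e%:C) nrE ltcR -[nr _](ger0_norm (nr_ge0 _)) -normrN -sub0r.
by near: n; exact: ul.
Unshelve. all: by end_near.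
Qed.

Lemma cvg_star (u : nat -> A) (l : A) : u @ \oo --> l ->
  (fun n => star (u n)) @ \oo --> star l.
Proof.
move=> /cvg_nrP ul; apply/cvg_nrP.
rewrite (_ : (fun n => _) = (fun n => nr (l - u n))) //.
by apply/funext => n; rewrite -starN -starD nr_star.
Qed.

Lemma cvg_mul (u v : nat -> A) (l m : A) : u @ \oo --> l -> v @ \oo --> m ->
  (fun n => u n * v n) @ \oo --> l * m.
Proof.
move=> /cvg_nrP ul /cvg_nrP vm; apply/cvg_nrP.
(* Bounds the two terms of l m - u v = l (m - v) + (l - u) v, using |v| <= |m| + |m - v|. *)
pose bound n := nr l * nr (m - v n) + nr (l - u n) * (nr m + nr (m - v n)).
apply: (@squeeze_cvgr _ _ _ _ (fun=> 0) bound).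
- near=> n; rewrite nr_ge0 /=.
  have -> : l * m - u n * v n = l * (m - v n) + (l - u n) * v n.
    by rewrite mulrBr mulrBl addrA subrK.
  apply: le_trans (ler_nrD _ _) _; apply: lerD; first exact: ler_nrM.
  apply: le_trans (ler_nrM _ _) _; apply: ler_wpM2l; first exact: nr_ge0.
  by rewrite -[v n in leLHS](subKr m) -(nrN (m - v n)) ler_nrD.
- exact: cvg_cst.
- rewrite -[X in _ --> X](_ : nr l * 0 + 0 * (nr m + 0) = 0); last first.
    by rewrite mulr0 mul0r addr0.
  apply: cvgD; apply: cvgM => //; first exact: cvg_cst.
  by apply: cvgD => //; exact: cvg_cst.
Unshelve. all: by end_near.
Qed.

(** Increments dominated by those of a bounded monotone real sequence telescope, so the sequence is
    Cauchy. Serves both the square root iteration and the Neumann series. *)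
Lemma cvg_majorant (u : nat -> A) (t : nat -> R) (M : R) :
  (forall n, nr (u n.+1 - u n) <= t n.+1 - t n) -> (forall n, t n <= M) ->
  cvgn u.
Proof.
move=> ut tM.
have t_nd : nondecreasing_seq t.
  by apply/nondecreasing_seqP => n;
    rewrite -subr_ge0 (le_trans _ (ut n)) ?nr_ge0.
have tc : cvgn t.
  by apply: nondecreasing_is_cvgn => //; exists M => _ [n _ <-].
have umn m k : nr (u (m + k)%N - u m) <= t (m + k)%N - t m.
  elim: k => [|k IH]; first by rewrite addn0 !subrr nr0.
  rewrite addnS.
  have := ler_nrD (u (m + k).+1 - u (m + k)%N) (u (m + k)%N - u m).
  by rewrite addrA subrK; have := ut (m + k)%N; lra.
apply/cauchy_cvgP/cauchy_exP => -[e e']; rewrite ltcE /= => /andP[/eqP -> e0].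
have /cvgrPdist_lt /(_ e e0) [N _ tN] := tc.
exists (u N), N => // n /= Nn.
rewrite -ball_normE /= -/(e%:C) nrE ltcR nr_distC.
have := umn N (n - N)%N; rewrite subnKC // => h; apply: le_lt_trans h _.
have := tN N (leqnn N); have := nondecreasing_cvgn_le t_nd tc n.
by rewrite /= ger0_norm ?subr_ge0; [lra|exact: nondecreasing_cvgn_le].
Qed.

End CStarAlgebra.

(** * Square roots by iteration, and the norm form of positivity *)

Section CStarSqrt.
Context {R : realType} {A : cstarAlgType R}.
Implicit Types (a b c d u v : A) (s t e : R).

Lemma cvg_uniq (u : nat -> A) (l m : A) :
  u @ \oo --> l -> u @ \oo --> m -> l = m.
Proof. exact: (@cvg_unique _ (@norm_hausdorff R[i] A)). Qed.

Lemma scalMM s t a b : (scal s * a) * (scal t * b) = scal (s * t) * (a * b).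
Proof. by rewrite scalM -!mulrA; congr (_ * _); rewrite !mulrA scalC. Qed.

Lemma comm_scal a t : GRing.comm a (scal t).
Proof. exact: scalC. Qed.

(* [1 - y] is the square root of [1 - c]; the iterates are majorized by those
   of the same recursion started with the number [1] in place of [c], which stay
   below [1], so the case [nr c = 1] is covered. *)
Lemma sqrt1B c : nr c <= 1 -> exists y : A,
  [/\ (1 - y) * (1 - y) = 1 - c, star c = c -> star y = y
    & forall d, GRing.comm d c -> GRing.comm d y].
Proof.
move=> c1.
pose y n := iter n (fun y => scal 2^-1 * (c + y * y)) 0.
pose t n := iter n (fun t => 2^-1 * (1 + t * t)) (0 : R).
have yS n : y n.+1 = scal 2^-1 * (c + y n * y n) by [].
have tS n : t n.+1 = 2^-1 * (1 + t n * t n) by [].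
have t01 n : 0 <= t n <= 1.
  by elim: n => [|n IH]; [rewrite lexx ler01|rewrite tS; nra].
have nrh a : nr (scal 2^-1 * a) = 2^-1 * nr a.
  by rewrite nrZ ger0_norm // invr_ge0 ler0n.
have yt n : nr (y n) <= t n.
  elim: n => [|n IH]; first by rewrite nr0.
  rewrite yS tS nrh; have := ler_nrD c (y n * y n); have := ler_nrM (y n) (y n).
  by have := nr_ge0 (y n); have := t01 n; nra.
have dyt n : nr (y n.+1 - y n) <= t n.+1 - t n.
  elim: n => [|n IH].
    by rewrite yS tS /= !(mulr0, subr0, addr0) nrh; lra.
  rewrite (yS n.+1) {2}(yS n) -mulrBr nrh.
  (* Noncommutative difference of squares; the same splitting for [t] majorizes it term by term. *)
  have -> : c + y n.+1 * y n.+1 - (c + y n * y n) =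
      y n.+1 * (y n.+1 - y n) + (y n.+1 - y n) * y n.
    by rewrite mulrBr mulrBl addrA subrK [c + _]addrC addrKA.
  have := ler_nrD (y n.+1 * (y n.+1 - y n)) ((y n.+1 - y n) * y n).
  have := ler_nrM (y n.+1) (y n.+1 - y n).
  have := ler_nrM (y n.+1 - y n) (y n).
  have := yt n; have := yt n.+1; have := nr_ge0 (y n); have := nr_ge0 (y n.+1).
  have := nr_ge0 (y n.+1 - y n); have := tS n.
  set p := nr (y n.+1 * _); set q := nr (_ * y n); set D := nr (y n.+1 - y n).
  set Y0 := nr (y n); set Y1 := nr (y n.+1).
  set r := nr (_ + _) => h D0 Y10 Y00 Y1t Y0t hq hp hr.
  have h1 : Y1 * D <= t n.+1 * (t n.+1 - t n) by apply: ler_pM.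
  have h2 : D * Y0 <= (t n.+1 - t n) * t n by apply: ler_pM.
  have := tS n.+1; lra.
have /cvg_ex[l yl] : cvgn y.
  by apply: (@cvg_majorant R A y t 1 dyt) => n; have /andP[] := t01 n.
(* The fixed point equation 2 l = c + l^2 is equivalent to (1 - l)^2 = 1 - c. *)
have eql : l = scal 2^-1 * (c + l * l).
  apply: (@cvg_uniq (fun n => y n.+1)); first by rewrite cvg_shiftS.
  apply: (@cvg_mul R A (fun=> _) (fun n => c + y n * y n)).
    exact: cvg_cst.
  by apply: cvgD; [exact: cvg_cst|exact: cvg_mul].
exists l; split.
- rewrite mulrBl mul1r mulrBr mulr1.
  have -> : l * l = l + l - c.
    have -> : l + l = scal 2 * l.
      by rewrite (_ : 2 = 1 + 1 :> R) // scalD scal1 mulrDl mul1r.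
    rewrite {3}eql mulrA -scalM mulfV ?pnatr_eq0 // scal1 mul1r.
    by rewrite addrAC subrr add0r.
  have -> : l - (l + l - c) = c - l.
    by rewrite opprB addrCA opprD (addrA l) subrr add0r.
  by rewrite opprB addrA subrK.
- move=> sc; apply: (@cvg_uniq y) => //.
  rewrite (_ : y = fun n => star (y n)); first exact: cvg_star.
  apply/funext; elim=> [|n IH]; first by rewrite star0.
  by rewrite yS starM star_scal starD starM -IH sc scalC.
- move=> d dc.
  have dy n : GRing.comm d (y n).
    elim: n => [|n IH]; first exact: commr0.
    rewrite yS; apply: commrM; first exact: comm_scal.
    by apply: commrD => //; exact: commrM.
  apply: (@cvg_uniq (fun n => d * y n)).
    by apply: (@cvg_mul R A (fun=> d)) => //; exact: cvg_cst.
  rewrite (_ : (fun n => _) = (fun n => y n * d)).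
    by apply: (@cvg_mul R A y (fun=> d)) => //; exact: cvg_cst.
  by apply/funext => n; exact: dy.
Qed.

(* This agrees with [cs_pos] (see [cs_posP]); unlike the spectral condition it
   is visibly stable under sums. *)
Definition norm_pos a := star a = a /\ exists t, nr (scal t - a) <= t.

Lemma norm_pos_sqrt a : norm_pos a -> exists s : A,
  [/\ star s = s, s * s = a & forall d, GRing.comm d a -> GRing.comm d s].
Proof.
move=> [sa [t ta]].
have t0 : 0 <= t by exact: le_trans (nr_ge0 _) ta.
(* Adding 1 allows division by [T] even when t = 0, and |T - a| <= T still holds. With c = 1 - a /
   T, the root of a is sqrt T times the root of 1 - c. *)
pose T := t + 1; have T0 : 0 < T by rewrite /T; lra.
have c1 : nr (1 - scal T^-1 * a) <= 1.
  have -> : 1 - scal T^-1 * a = scal T^-1 * (scal T - a).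
    by rewrite mulrBr -scalM mulVf ?gt_eqF // scal1.
  rewrite nrZ ger0_norm ?invr_ge0 ?(ltW T0) // ler_pdivrMl // mulr1.
  have -> : scal T - a = scal 1 + (scal t - a).
    by rewrite addrA -scalD (addrC 1).
  have := ler_nrD (scal 1) (scal t - a); have := @nr_scal R A 1.
  by rewrite normr1 /T; lra.
have [y [ysq sy cy]] := sqrt1B _ c1.
exists (scal (Num.sqrt T) * (1 - y)); split.
- rewrite starM star_scal -scalC starD starN star1 sy //.
  by rewrite starD starN starM star1 star_scal sa scalC.
- rewrite scalMM ysq subKr -expr2 sqr_sqrtr ?(ltW T0) // mulrA.
  rewrite -scalM mulfV ?gt_eqF //.
  by rewrite scal1 mul1r.
- move=> d da; apply: commrM; first exact: comm_scal.
  apply: commrB; first exact: commr1.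
  apply: cy; apply: commrB; first exact: commr1.
  by apply: commrM => //; exact: comm_scal.
Qed.

(* [u + i v] is a scalar multiple of a unitary, and [u] is its real part. *)
Lemma nr_sq_le u v t : star u = u -> star v = v -> GRing.comm u v ->
  0 <= t -> u * u + v * v = scal t -> nr (u * u) <= t.
Proof.
move=> su sv uv t0 uvt.
pose z := u + 'i *: v.
have sz : star z = u - 'i *: v.
  rewrite starD starZ su sv; congr (_ + _).
  rewrite -scaleNr; congr (_ *: _); apply/eqP.
  by rewrite eq_complex /= oppr0 !eqxx.
have szz : star z * z = scal t.
  rewrite sz mulrBl !mulrDr -!scaleAl' -!scaleAr' scalerA.
  rewrite -[v * u]uv opprD addrA addrK -uvt; congr (_ + _).
  have ii : - ('i * 'i) = 1 :> R[i] by rewrite -expr2 sqr_i opprK.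
  rewrite -scaleNr ii.
  by rewrite scale1r.
have z2 : nr z ^+ 2 <= t.
  rewrite -nr_starM szz; apply: le_trans (@nr_scal R A t) _.
  by rewrite ger0_norm.
have uz : u = scal 2^-1 * (z + star z).
  rewrite sz addrACA subrr addr0 -[u + u](_ : scal 2 * u = _).
    by rewrite mulrA -scalM mulVf ?pnatr_eq0 // scal1 mul1r.
  by rewrite (_ : 2 = 1 + 1 :> R) // scalD scal1 mulrDl mul1r.
have : nr u <= nr z.
  rewrite {1}uz nrZ ger0_norm ?invr_ge0 ?ler0n //.
  by have := ler_nrD z (star z); rewrite nr_star; lra.
rewrite nr_sq //; have := nr_ge0 u; nra.
Qed.

End CStarSqrt.

(** * Closure properties of the positive cone and monotonicity of the norm *)

Section CStarOrder.
Context {R : realType} {A : cstarAlgType R}.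
Implicit Types (a b c d p q r u v x : A) (s t e : R).

Lemma norm_posB a t : star a = a -> nr a <= t -> norm_pos (scal t - a).
Proof.
move=> sa at_; split; first by rewrite starD starN star_scal sa.
by exists t; rewrite subKr.
Qed.

Lemma norm_pos_scal t : 0 <= t -> norm_pos (@scal R A t).
Proof.
by move=> t0; split; [exact: star_scal|exists t; rewrite subrr nr0].
Qed.

Lemma norm_posD a b : norm_pos a -> norm_pos b -> norm_pos (a + b).
Proof.
move=> [sa [s sta]] [sb [t tb]]; split; first by rewrite starD sa sb.
exists (s + t); rewrite scalD opprD addrACA.
by apply: le_trans (ler_nrD _ _) _; exact: lerD.
Qed.

(** With v the root of t - b^2, which commutes with b, v^2 + b^2 = t and [nr_sq_le] bounds v^2. *)
Lemma nr_scalB_sq b t : star b = b -> nr (b * b) <= t ->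
  nr (scal t - b * b) <= t.
Proof.
move=> sb bt; have t0 := le_trans (nr_ge0 _) bt.
have sbb : star (b * b) = b * b by rewrite starM sb.
have [v [sv vv cv]] := norm_pos_sqrt _ (norm_posB _ _ sbb bt).
rewrite -vv; apply: (@nr_sq_le R A v b) => //; last by rewrite vv subrK.
apply/commr_sym/cv; apply: commrB; first exact: comm_scal.
by apply: commrM.
Qed.

Lemma norm_pos_sq b : star b = b -> norm_pos (b * b).
Proof.
move=> sb; split; first by rewrite starM sb.
by exists (nr (b * b)); exact: nr_scalB_sq.
Qed.

(** The existential constant in [norm_pos] may thus be taken to be any bound of the norm of a. *)
Lemma nr_scalB a t : norm_pos a -> nr a <= t -> nr (scal t - a) <= t.
Proof.
by move=> /norm_pos_sqrt[b [sb <- _]]; exact: nr_scalB_sq.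
Qed.

Lemma norm_posZ a t : 0 <= t -> norm_pos a -> norm_pos (scal t * a).
Proof.
move=> t0 /norm_pos_sqrt[b [sb <- _]].
have -> : scal t * (b * b) = (scal (Num.sqrt t) * b) * (scal (Num.sqrt t) * b).
  by rewrite scalMM -(expr2 (Num.sqrt t)) sqr_sqrtr.
by apply: norm_pos_sq; rewrite starM star_scal sb scalC.
Qed.

(** The element |q| - p = (|q| - q) + (q - p) is positive. Its root v and the root u of p commute
    and satisfy u^2 + v^2 = |q|, so [nr_sq_le] applies. *)
Lemma nr_le p q : norm_pos p -> norm_pos (q - p) -> nr p <= nr q.
Proof.
move=> pp pqp.
have sq : star q = q by rewrite -(subrK p q) starD pqp.1 pp.1.
have := norm_posD _ _ (norm_posB _ _ sq (lexx _)) pqp.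
rewrite addrA subrK => /norm_pos_sqrt[v [sv vv cv]].
have [u [su uu cu]] := norm_pos_sqrt _ pp.
rewrite -uu; apply: (@nr_sq_le R A u v) => //.
- apply: cv; apply: commrB; first exact: comm_scal.
  exact/commr_sym/cu.
- exact: nr_ge0.
- by rewrite uu vv (addrC p) subrK.
Qed.

(** Testing a + e against the bound |a| + e cancels e on the left: | |a| - a | <= |a| + e for every
    e > 0. *)
Lemma norm_pos_closed a : star a = a ->
  (forall e, 0 < e -> norm_pos (a + scal e)) -> norm_pos a.
Proof.
move=> sa ae; split=> //; exists (nr a); apply/ler_addgt0Pr => e e0.
have h : nr (a + scal e) <= nr a + e.
  apply: le_trans (ler_nrD _ _) _; rewrite lerD2l.
  by apply: le_trans (nr_scal _) _; rewrite gtr0_norm.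
by have := nr_scalB _ _ (ae e e0) h; rewrite scalD opprD addrACA subrr addr0.
Qed.

(** * Invertibility, and agreement of spectral and norm positivity *)

Lemma cs_invertibleM a b : cs_invertible a -> cs_invertible b ->
  cs_invertible (a * b).
Proof.
move=> [a' [aa' a'a]] [b' [bb' b'b]]; exists (b' * a'); split.
  by rewrite mulrA -(mulrA a) bb' mulr1.
by rewrite mulrA -(mulrA b') a'a mulr1.
Qed.

Lemma cs_invertibleN a : cs_invertible a -> cs_invertible (- a).
Proof. by move=> [b [ab ba]]; exists (- b); rewrite !mulrNN. Qed.

Lemma cs_invertible_scal t : t != 0 -> cs_invertible (@scal R A t).
Proof.
by move=> t0; exists (scal t^-1); rewrite -!scalM mulfV // mulVf // scal1.
Qed.

(** If r inverts u v, then v r is a right inverse of u and r v a left one, so they coincide. *)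
Lemma cs_invertible_commM u v : GRing.comm u v -> cs_invertible (u * v) ->
  cs_invertible u.
Proof.
move=> uv [r [uvr ruv]]; exists (v * r); split; first by rewrite mulrA.
have rvu : r * v * u = 1 by rewrite -mulrA -uv.
suff <- : r * v = v * r by [].
by rewrite -[r * v]mulr1 -uvr -(mulrA u) (mulrA _ u) rvu mul1r.
Qed.

Lemma neumann c : nr c < 1 -> cs_invertible (1 - c).
Proof.
move=> c1.
have c0 := nr_ge0 c.
(* Partial sums of the geometric series of c; [t] below gives those of the real series of powers of
   |c|, bounded by 1 / (1 - |c|). *)
pose x n := iter n (fun x => 1 + c * x) 0.
have xS n : x n.+1 = 1 + c * x n by [].
have dx n : nr (x n.+1 - x n) <= nr c ^+ n.
  elim: n => [|n IH]; first by rewrite xS /= mulr0 addr0 subr0 expr0 nr1_le1.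
  rewrite (xS n.+1) {2}(xS n) opprD addrACA subrr add0r -mulrBr exprS.
  by apply: le_trans (ler_nrM _ _) _; exact: ler_wpM2l.
pose t n := (1 - nr c ^+ n) / (1 - nr c).
have d0 : 0 < 1 - nr c by rewrite subr_gt0.
have /cvg_ex[l xl] : cvgn x.
  apply: (@cvg_majorant R A x t (1 - nr c)^-1) => n.
    rewrite -mulrBl (_ : _ / _ = nr c ^+ n) //.
    by rewrite exprS; field; rewrite gt_eqF.
  rewrite /t -[leRHS]mul1r ler_wpM2r ?invr_ge0 ?(ltW d0) //.
  by rewrite gerBl exprn_ge0.
have eql : l = 1 + c * l.
  apply: (@cvg_uniq _ _ (fun n => x n.+1)); first by rewrite cvg_shiftS.
  apply: cvgD; first exact: cvg_cst.
  by apply: (@cvg_mul R A (fun=> c)) => //; exact: cvg_cst.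
have cl : c * l = l * c.
  apply: (@cvg_uniq _ _ (fun n => c * x n)).
    by apply: (@cvg_mul R A (fun=> c)) => //; exact: cvg_cst.
  rewrite (_ : (fun n => _) = (fun n => x n * c)).
    by apply: (@cvg_mul R A x (fun=> c)) => //; exact: cvg_cst.
  apply/funext; elim=> [|n IH]; first by rewrite mulr0 mul0r.
  by rewrite xS mulrDr mulrDl mulr1 mul1r {1}IH mulrA.
exists l; split; first by rewrite mulrBl mul1r {1}eql addrK.
by rewrite mulrBr mulr1 -cl {1}eql addrK.
Qed.

(** With T = |a|, a + e = (T + e) (1 - (T - a) / (T + e)) and |T - a| <= T < T + e, so the Neumann
    series inverts the last factor. *)
Lemma norm_pos_invertible a e : norm_pos a -> 0 < e ->
  cs_invertible (a + scal e).
Proof.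
move=> pa e0; set T := nr a.
have T0 : 0 <= T := nr_ge0 a.
have Te0 : 0 < T + e by lra.
have -> : a + scal e =
    scal (T + e) * (1 - scal (T + e)^-1 * (scal T - a)).
  rewrite mulrBr mulr1 mulrA -scalM mulfV ?gt_eqF // scal1 mul1r.
  by rewrite opprB addrCA scalD addrAC subrr add0r.
apply: cs_invertibleM; first by apply: cs_invertible_scal; rewrite gt_eqF.
apply: neumann; rewrite nrZ ger0_norm ?invr_ge0 ?(ltW Te0) //.
rewrite ltr_pdivrMl // mulr1; have := nr_scalB _ _ pa (lexx T); lra.
Qed.

Lemma star_inv a b : star a = a -> a * b = 1 -> b * a = 1 -> star b = b.
Proof.
move=> sa ab ba.
rewrite -[LHS]mulr1 -ab mulrA -[X in _ * X * _]sa -starM ab star1.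
by rewrite mul1r.
Qed.

(** Let r be the inverse of x, M > |r^2| and v the root of M - r^2. Then (x v)^2 = M x^2 - 1, hence
    x^2 - 1/M = (x v)^2 / M is positive. *)
Lemma sq_sub_scal_pos x : star x = x -> cs_invertible x ->
  exists2 e, 0 < e & norm_pos (x * x - scal e).
Proof.
move=> sx [r [xr rx]]; have sr := star_inv _ _ sx xr rx.
have M0 : 0 < nr (r * r) + 1 by have := nr_ge0 (r * r); lra.
set M := nr (r * r) + 1 in M0.
have srr : star (r * r) = r * r by rewrite starM sr.
have rrM : nr (r * r) <= M by rewrite lerDl.
have [v [sv vv cv]] := norm_pos_sqrt _ (norm_posB _ _ srr rrM).
have xv : GRing.comm x v.
  apply: cv; apply: commrB; first exact: comm_scal.
  by rewrite /GRing.comm mulrA xr mul1r -mulrA rx mulr1.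
exists M^-1; first by rewrite invr_gt0.
have -> : x * x - scal M^-1 = scal M^-1 * ((x * v) * (x * v)).
  have -> : (x * v) * (x * v) = scal M * (x * x) - 1.
    have <- : x * (r * r) * x = 1 by rewrite mulrA xr mul1r rx.
    by rewrite {2}xv mulrA -(mulrA x) vv mulrBr mulrBl scalC -(mulrA _ x x).
  rewrite mulrBr mulr1 (mulrA (scal M^-1)) -scalM mulVf ?gt_eqF //.
  by rewrite scal1 mul1r.
apply: norm_posZ; first by rewrite invr_ge0 ltW.
by apply: norm_pos_sq; rewrite starM sx sv.
Qed.

(* If [m > 0] were the least number making [a + m] positive, then [a + m]
   would be an invertible square, and subtracting a small constant would keep
   it positive. *)
Lemma cs_pos_norm_pos a : cs_pos a -> norm_pos a.
Proof.
move=> [sa spa].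
pose E := [set m | 0 <= m /\ norm_pos (a + scal m)].
have infE : has_inf E.
  split; last by exists 0 => m [].
  exists (nr a); split; first exact: nr_ge0.
  rewrite addrC -[a in _ + a]opprK; apply: norm_posB; last by rewrite nrN.
  by rewrite starN sa.
set m := inf E.
have m0 : 0 <= m by apply: lb_le_inf; [exact: infE.1|move=> t []].
(* The infimum is attained: some t in [E] lies below m + e, so a + m + e = (a + t) + (m + e - t) is
   positive for each e > 0. *)
have pam : norm_pos (a + scal m).
  apply: norm_pos_closed; first by rewrite starD sa star_scal.
  move=> e e0; have [t [t0 pt] tm] := inf_adherent e0 infE.
  have -> : a + scal m + scal e = a + scal t + scal (m + e - t).
    by rewrite -!addrA -!scalD; congr (_ + scal _); ring.
  by apply: norm_posD => //; apply: norm_pos_scal; rewrite subr_ge0 ltW.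
move: m0; rewrite le_eqVlt => /orP[/eqP m0|m0].
  by rewrite -m0 scal0 addr0 in pam.
(* Here m > 0, so -m is outside the spectrum. *)
have inv : cs_invertible (a + scal m).
  apply: contrapT => ninv.
  have : spectrum a (- m)%:C.
    move=> /cs_invertibleN; rewrite opprB => h; apply: ninv; move: h.
    by rewrite -[_ *: _]/(scal (- m)) scalN opprK.
  by move/spa => /=; rewrite lecR; lra.
have [x [sx xx _]] := norm_pos_sqrt _ pam.
have invx : cs_invertible x.
  by apply: (@cs_invertible_commM _ x) => //; rewrite xx.
have [e e0 pe] := sq_sub_scal_pos _ sx invx.
(* Truncation at 0 keeps the new element in [E], yet it is smaller than m since m and e are
   positive. *)
have : E (Num.max 0 (m - e)).
  split; first by rewrite le_max lexx.
  have -> : a + scal (Num.max 0 (m - e)) =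
      (x * x - scal e) + scal (Num.max 0 (m - e) - (m - e)).
    by rewrite xx -scalN -!addrA -!scalD; congr (_ + scal _); ring.
  apply: norm_posD => //; apply: norm_pos_scal.
  by rewrite subr_ge0 le_max lexx orbT.
move/(inf_lbound infE.2); rewrite -/m le_max; lra.
Qed.

(** It is a factor of (x + i t) (x - i t) = x^2 + t^2, a positive element plus a positive scalar,
    and the two factors commute. *)
Lemma invertible_add_imaginary x t : star x = x -> t != 0 ->
  cs_invertible (x + 'i *: scal t).
Proof.
move=> sx t0.
have [y yE] : exists y : A, y = 'i *: scal t by exists ('i *: scal t).
rewrite -yE.
have xy : GRing.comm x y by rewrite /GRing.comm yE -scaleAr' -scaleAl' scalC.
have yy : y * y = - scal (t * t).
  by rewrite yE -scaleAl' -scaleAr' scalerA -expr2 sqr_i scaleN1r scalM.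
apply: (@cs_invertible_commM _ (x - y)).
  by apply/commr_sym; apply: commrD; apply/commr_sym; apply: commrB => //;
    apply/commr_sym.
have -> : (x + y) * (x - y) = x * x + scal (t * t).
  by rewrite mulrBr !mulrDl yy -[y * x]xy opprD opprK addrA addrK.
apply: norm_pos_invertible; last by rewrite -expr2 exprn_even_gt0.
exact: norm_pos_sq.
Qed.

Lemma nonreal_invertible a (k : R[i]) : star a = a -> complex.Im k != 0 ->
  cs_invertible (k *: (1 : A) - a).
Proof.
case: k => s t /= sa t0.
have -> : (s +i* t) *: (1 : A) - a = (scal s - a) + 'i *: scal t.
  rewrite addrAC /scal scalerA -scalerDl; congr (_ *: _ - _).
  apply/eqP; rewrite eq_complex /=.
  by rewrite !(mul0r, mulr0, mul1r, subr0, addr0, add0r) !eqxx.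
apply: invertible_add_imaginary => //.
by rewrite starD starN star_scal sa.
Qed.

(** Self-adjointness excludes nonreal spectrum, and the hypothesis excludes negative reals. *)
Lemma cs_pos_invertible a : star a = a ->
  (forall e, 0 < e -> cs_invertible (a + scal e)) -> cs_pos a.
Proof.
move=> sa ae; split=> // -[s t] /= ninv.
have [t0|t0] := eqVneq t 0; last by case: ninv; exact: nonreal_invertible.
rewrite t0 lecE /= eqxx /= leNgt; apply/negP => s0; apply: ninv.
have /ae/cs_invertibleN : 0 < - s by rewrite oppr_gt0.
by rewrite opprD scalN opprK addrC t0.
Qed.

Lemma cs_posP a : cs_pos a <-> norm_pos a.
Proof.
split; first exact: cs_pos_norm_pos.
move=> pa; apply: cs_pos_invertible; first exact: pa.1.
by move=> e e0; exact: norm_pos_invertible.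
Qed.

(** Uses the spectral criterion. With r the inverse of x, x a x + e = x (a + e r^2) x; as r^2 - t is
    positive for some t > 0, the middle factor is a positive element plus e t, hence invertible. *)
Lemma conj_norm_pos a x : norm_pos a -> star x = x -> cs_invertible x ->
  norm_pos (x * a * x).
Proof.
move=> pa sx [r [xr rx]]; have sr := star_inv _ _ sx xr rx.
apply/cs_posP/cs_pos_invertible; first by rewrite !starM sx pa.1 mulrA.
move=> e e0.
have [t t0 pt] : exists2 t, 0 < t & norm_pos (r * r - scal t).
  by apply: sq_sub_scal_pos => //; exists x.
have -> : x * a * x + scal e = x * (a + scal e * (r * r)) * x.
  rewrite mulrDr mulrDl; congr (_ + _).
  by rewrite mulrA scalC -!mulrA rx mulr1 xr mulr1.
have invx : cs_invertible x by exists r.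
apply: cs_invertibleM => //; apply: cs_invertibleM => //.
have -> : a + scal e * (r * r) = (a + scal e * (r * r - scal t)) + scal (e * t).
  by rewrite mulrBr -scalM addrA subrK.
apply: norm_pos_invertible; last exact: mulr_gt0.
by apply: norm_posD => //; apply: norm_posZ => //; exact: ltW.
Qed.

(* Test the hypothesis on [a = (q + e)^(-1/2)], for which [a q a <= 1]. *)
Lemma norm_pos_of_conj_norm p q : norm_pos p -> norm_pos q ->
  (forall a, nr (a * p * star a) <= nr (a * q * star a)) -> norm_pos (q - p).
Proof.
move=> pp pq pq_le.
apply: norm_pos_closed; first by rewrite starD starN pp.1 pq.1.
move=> e e0.
have pqe : norm_pos (q + scal e).
  by apply: norm_posD => //; exact/norm_pos_scal/ltW.
have [x [sx xx cx]] := norm_pos_sqrt _ pqe.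
have invx : cs_invertible x.
  by apply: (@cs_invertible_commM _ x) => //; rewrite xx;
    exact: norm_pos_invertible.
have [r [xr rx]] := invx; have sr := star_inv _ _ sx xr rx.
have invr : cs_invertible r by exists x.
have rqr : nr (r * q * r) <= 1.
  apply: le_trans (_ : nr (1 : A) <= 1); last exact: nr1_le1.
  apply: nr_le; first exact: conj_norm_pos.
  (* From q = x^2 - e and r x = x r = 1. *)
  have -> : 1 - r * q * r = scal e * (r * r).
    rewrite -[q](addrK (scal e)) -xx mulrBr mulrBl !mulrA rx mul1r xr.
    by rewrite scalC subKr.
  by apply: norm_posZ; [exact: ltW|exact: norm_pos_sq].
have rpr : nr (r * p * r) <= 1.
  by apply: le_trans rqr; have := pq_le r; rewrite sr.
(* Conjugating the positive 1 - r p r by x gives x^2 - p = q + e - p. *)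
have := norm_posB _ _ (conj_norm_pos _ _ pp sr invr).1 rpr.
move=> /(conj_norm_pos _ x)/(_ sx invx).
rewrite scal1 mulrBr mulrBl mulr1 xx -!mulrA rx mulr1 mulrA xr mul1r.
by rewrite addrAC.
Qed.

End CStarOrder.

(** * Behaviour of inner products and frame sums under the module action *)

Section FrameSum.
Context {R : realType} {A : cstarAlgType R} {H : hilbertModType A}.

(** Once |u_N - l| < e, l + e = u_N + (e - (u_N - l)) is a sum of positive elements; then let e tend
    to 0. *)
Lemma norm_pos_cvg (u : nat -> A) (l : A) :
  (forall n, norm_pos (u n)) -> u @ \oo --> l -> norm_pos l.
Proof.
move=> pu ul.
have sl : star l = l.
  apply: (@cvg_uniq _ _ u) => //.
  rewrite (_ : u = fun n => star (u n)); first exact: cvg_star.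
  by apply/funext => n; rewrite (pu n).1.
apply: norm_pos_closed => // e e0.
have /cvg_nrP/cvgrPdist_lt/(_ e e0)[N _ /(_ N (leqnn N))] := ul.
rewrite /= sub0r normrN ger0_norm ?nr_ge0 // nr_distC => /ltW uNl.
have -> : l + scal e = u N + (scal e - (u N - l)).
  by rewrite opprB addrCA [_ + (l - _)]addrC subrK addrC.
apply: norm_posD => //; apply: norm_posB => //.
by rewrite starD starN sl (pu N).1.
Qed.

Lemma innerZl (a : A) (x y : H) : inner (a *: x) y = a * inner x y.
Proof.
have inner0 : inner (0 : H) y = 0 by rewrite -(subrr x) innerBl subrr.
by rewrite -[a *: x]addr0 inner_linear inner0 addr0.
Qed.

Lemma innerZ (a : A) (x : H) :
  inner (a *: x) (a *: x) = a * inner x x * star a.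
Proof.
by rewrite innerZl inner_star innerZl starM -inner_star mulrA.
Qed.

(** The difference of the two sides is orthogonal to every vector, in particular to itself. Stated
    for a pair of functions so that it covers an operator and its adjoint alike. *)
Lemma adjoint_pair_linear (T S : H -> H) :
  (forall x y, inner (T x) y = inner x (S y)) ->
  forall (a : A) x, T (a *: x) = a *: T x.
Proof.
move=> TS a x; apply/eqP; rewrite -subr_eq0; apply/eqP/inner_definite.
by rewrite innerBl innerZl !TS innerZl subrr.
Qed.

Lemma adjointableZ (T : adjointable H) (a : A) (x : H) : T (a *: x) = a *: T x.
Proof. exact: (@adjoint_pair_linear T (adjoint T) (adjointP T)). Qed.

Lemma adjointZ (T : adjointable H) (a : A) (x : H) :
  adjoint T (a *: x) = a *: adjoint T x.
Proof.
apply: (@adjoint_pair_linear (adjoint T) T) => {}x y.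
by rewrite inner_star -adjointP -inner_star.
Qed.

Lemma inner_norm_pos (x : H) : norm_pos (inner x x).
Proof. exact/cs_posP/inner_pos. Qed.

Lemma hnorm_sqr (x : H) : hnorm x ^+ 2 = (nr (inner x x))%:C.
Proof. by rewrite /hnorm /norm_of_inner sqrtCK nrE. Qed.

Lemma frame_sum_cvg (J : set nat) (T : nat -> adjointable H) (x : H) :
  cvgn (frame_psum J T x) -> frame_psum J T x @ \oo --> frame_sum J T x.
Proof. by []. Qed.

Lemma frame_sum_norm_pos (J : set nat) (T : nat -> adjointable H) (x : H) :
  cvgn (frame_psum J T x) -> norm_pos (frame_sum J T x).
Proof.
move=> /frame_sum_cvg; apply: norm_pos_cvg => n.
apply: (big_ind (@norm_pos R A)).
- by rewrite -scal0; exact: norm_pos_scal.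
- exact: norm_posD.
- by move=> i _; exact: inner_norm_pos.
Qed.

Lemma frame_sumZ (J : set nat) (T : nat -> adjointable H) (a : A) (x : H) :
  (forall x, cvgn (frame_psum J T x)) ->
  frame_sum J T (a *: x) = a * frame_sum J T x * star a.
Proof.
move=> cvgT; apply: (@cvg_uniq _ _ (frame_psum J T (a *: x))).
  exact/frame_sum_cvg.
rewrite (_ : frame_psum J T (a *: x) =
             (fun n => a * frame_psum J T x n * star a)).
  apply: (@cvg_mul R A (fun n => a * frame_psum J T x n) (fun=> star a));
    last exact: cvg_cst.
  apply: (@cvg_mul R A (fun=> a)); first exact: cvg_cst.
  exact/frame_sum_cvg.
apply/funext => n; rewrite /frame_psum mulr_sumr mulr_suml.
by apply: eq_bigr => i _; rewrite adjointableZ innerZ.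
Qed.

End FrameSum.

(** * Equivalence of the inequalities in [A] with the norm inequalities *)

Theorem theorem4p3 (R : realType) (A : cstarAlgType R) (H : hilbertModType A)
    (K : adjointable H) (J : set nat) (T : nat -> adjointable H)
    (cvgT : forall x : H, cvgn (frame_psum J T x)) :
  K_operator_frame K J T <->
  exists a b : R, [/\ 0 < a, 0 < b & forall x : H,
    a%:C * hnorm (adjoint K x) ^+ 2 <= `|frame_sum J T x| <=
    b%:C * hnorm x ^+ 2].
Proof.
have normE (a b : R) (x : H) :
    (a%:C * hnorm (adjoint K x) ^+ 2 <= `|frame_sum J T x| <=
     b%:C * hnorm x ^+ 2) =
    (a * nr (inner (adjoint K x) (adjoint K x)) <= nr (frame_sum J T x) <=
     b * nr (inner x x)).
  by rewrite !hnorm_sqr nrE -!rmorphM /= !lecR.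
(* The same constants serve in both directions; the forward one is monotonicity of the norm on
   positive elements. *)
have pS x : norm_pos (frame_sum J T x) by exact: frame_sum_norm_pos.
split=> [[a [b [a0 b0 ab]]]|[a [b [a0 b0 ab]]]]; exists a, b; split=> // x.
  have [_ /cs_posP lo /cs_posP hi] := ab x; rewrite normE.
  apply/andP; split.
    rewrite -(gtr0_norm a0) -nrZ scalE; apply: nr_le => //.
    by rewrite -scalE; apply: norm_posZ (inner_norm_pos _); exact: ltW.
  by rewrite -(gtr0_norm b0) -nrZ scalE; exact: nr_le.
(* The norm inequality at [c *: x] is the conjugated inequality that [norm_pos_of_conj_norm]
   requires. *)
have nab c : a * nr (c * inner (adjoint K x) (adjoint K x) * star c) <=
    nr (c * frame_sum J T x * star c) <= b * nr (c * inner x x * star c).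
  by have := ab (c *: x); rewrite normE adjointZ !innerZ frame_sumZ.
have conjZ (t : R) (c p : A) : 0 < t ->
    nr (c * (scal t * p) * star c) = t * nr (c * p * star c).
  by move=> t0; rewrite (mulrA c) scalC -!mulrA nrZ gtr0_norm.
split=> //; apply/cs_posP; rewrite -scalE;
  apply: norm_pos_of_conj_norm => //.
- by apply: norm_posZ (inner_norm_pos _); exact: ltW.
- by move=> c; rewrite conjZ //; have /andP[] := nab c.
- by apply: norm_posZ (inner_norm_pos _); exact: ltW.
- by move=> c; rewrite conjZ //; have /andP[] := nab c.
Qed.
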